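(* For every prime power $q$, Homma's constant satisfies $D(q) \le q-1$.
   Context: Let $q$ be a prime power and $\mathbb{F}_q$ the finite field with $q$ elements. For a positive integer $d$, let $M_q(d)$ denote the maximum of $|\mathcal{X}(\mathbb{F}_q)|$ (the number of $\mathbb{F}_q$-rational points) taken over all irreducible projective curves $\mathcal{X}$ of degree $d$ defined over $\mathbb{F}_q$ lying in a projective space $\mathbb{P}^n$ over $\mathbb{F}_q$ of any dimension $n$ (the dimension is not fixed; the curves need not be nonsingular). Homma's constant is $D(q) := \limsup_{d\to\infty} M_q(d)/d$. *)

(* Defs.v *)
From HB Require Import structures.
From mathcomp Require Import all_boot all_order all_algebra all_field.
From mathcomp Require Import mpoly.
From mathcomp Require Import all_classical all_reals all_analysis.
From mathcomp Require Import Rstruct.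

Set Implicit Arguments.
Unset Strict Implicit.
Unset Printing Implicit Defensive.

Import Order.TTheory GRing.Theory Num.Theory.
Local Open Scope ring_scope.

(* Polynomial ring F[x_0, ..., x_n]: homogeneous coordinates of P^n. *)
Notation poly_ring F n := (mpoly.mpoly n.+1 F).

Definition is_homog (F : fieldType) (n m : nat) (p : poly_ring F n) : bool :=
  all (fun mo => mpoly.mdeg mo == m) (mpoly.msupp p).

Definition homog_comp (F : fieldType) (n m : nat) (p : poly_ring F n)
  : poly_ring F n :=
  \sum_(mo <- mpoly.msupp p | mpoly.mdeg mo == m)
     (mpoly.mcoeff mo p) *: mpoly.mpolyX F mo.

Definition homog_prime_ideal (F : fieldType) (n : nat)
    (I : poly_ring F n -> Prop) : Prop :=
  [/\ I 0,
      (forall p q, I p -> I q -> I (p + q)),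
      (forall p q, I q -> I (p * q)) &
      (forall p m, I p -> I (homog_comp m p))] /\
  (~ I 1 /\ (forall p q, I (p * q) -> I p \/ I q)).

(* Hilbert function: dim_F (F[x]_m / I_m) = k, i.e. some k homogeneous
   degree-m polynomials are linearly independent modulo I, and no k+1 are. *)
Definition indep_mod (F : fieldType) (n m k : nat)
    (I : poly_ring F n -> Prop) : Prop :=
  exists f : 'I_k -> poly_ring F n,
    (forall i, is_homog m (f i)) /\
    (forall c : 'I_k -> F, I (\sum_(i < k) c i *: f i) -> forall i, c i = 0).

Definition hilbert_fun_eq (F : fieldType) (n : nat)
    (I : poly_ring F n -> Prop) (m k : nat) : Prop :=
  indep_mod m k I /\ ~ indep_mod m k.+1 I.

(* I is the (homogeneous, prime) ideal of an F-irreducible projective curve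
   of degree d in P^n: Hilbert polynomial d*m + c with d >= 1. *)
Definition irred_curve_of_degree (F : fieldType) (n : nat)
    (I : poly_ring F n -> Prop) (d : nat) : Prop :=
  [/\ homog_prime_ideal I, (0 < d)%N &
      exists c : int, exists m0 : nat, forall m : nat, (m0 <= m)%N ->
        exists k : nat, hilbert_fun_eq I m k /\ (k%:Z = (d * m)%:Z + c)%R].

(* Points of P^n(F) in normalized homogeneous coordinates:
   first nonzero coordinate equal to 1. *)
Definition normalized (F : fieldType) (n : nat) (x : 'I_n.+1 -> F) : Prop :=
  exists i : 'I_n.+1, x i = 1 /\ forall j : 'I_n.+1, (j < i)%N -> x j = 0.

Definition num_rat_points (F : finFieldType) (n : nat)
    (I : poly_ring F n -> Prop) : nat :=
  #|[set x : {ffun 'I_n.+1 -> F} |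
      `[< normalized x /\ forall p, I p -> mpoly.meval x p = 0 >] ]|.

Definition M_q (F : finFieldType) (d : nat) : \bar Rdefinitions.R :=
  ereal_sup [set (k%:R)%:E | k in
    [set k : nat | exists n : nat, exists I : poly_ring F n -> Prop,
       irred_curve_of_degree I d /\ k = num_rat_points I]].

Definition Homma_const (F : finFieldType) : \bar Rdefinitions.R :=
  limn_esup (fun d : nat => (M_q F d * ((d%:R)^-1)%:E)%E).

(* Main.v *)
Require Import Defs.
From HB Require Import structures.
From mathcomp Require Import all_boot all_order all_algebra all_field.
From mathcomp Require Import mpoly.
From mathcomp Require Import all_classical all_reals all_analysis.
From mathcomp Require Import Rstruct.
From mathcomp Require Import lra.

(** Let q = #|F|, let X be a curve of degree d with N rational points, and let h
    be a random linear form with coefficients in F. At a rational point P the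
    residue field is F, so the local ring of X at P has a descending chain of
    ideals J_0 > J_1 > ... whose successive quotients are one-dimensional. Hence
    the linear forms lying in J_k have codimension at most k, and h lies in J_k
    with probability at least q^-k. If h lies in J_k then h meets X at P with
    multiplicity at least k, so for each K the expected intersection number of X
    with h at P is at least q^-1 + ... + q^-K. By Bezout the total over all P is at
    most d as long as h does not vanish on X; the forms vanishing on X
    contribute at most K in total, because N points impose at least log_q N
    independent conditions on linear forms. Therefore
    N (q^-1 + ... + q^-K) <= d + K, and letting d, then K, tend to infinity
    bounds limsup N / d by q - 1. *)

Set Implicit Arguments.
Unset Strict Implicit.
Unset Printing Implicit Defensive.

Import Order.TTheory GRing.Theory Num.Theory.
Local Open Scope ring_scope.

(** * Composition series of a local ring *)

Definition is_ideal (R : comNzRingType) (I : R -> Prop) : Prop :=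
  [/\ I 0, forall p q, I p -> I q -> I (p + q) & forall p q, I q -> I (p * q)].

(** The ideal [B + (gs)], with one multiplier peeled off per generator so that finite generation is
    handled by induction on [gs]. *)
Fixpoint ideal_adjoin (R : comNzRingType) (B : R -> Prop) (gs : seq R) (f : R)
    : Prop :=
  if gs is g :: gs' then exists a, ideal_adjoin B gs' (f - a * g) else B f.

Section Ideals.
Variables (R : comNzRingType).
Implicit Types (I B : R -> Prop) (f g u : R) (gs : seq R).

Lemma ideal_opp I f : is_ideal I -> I f -> I (- f).
Proof. by case=> _ _ IM If; rewrite -mulN1r; apply: IM. Qed.

Lemma ideal_sub I f g : is_ideal I -> I f -> I g -> I (f - g).
Proof. by move=> idI If Ig; case: (idI) => _ ID _; apply: ID => //; apply: ideal_opp. Qed.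

Lemma ideal_mulr I f g : is_ideal I -> I f -> I (f * g).
Proof. by case=> _ _ IM If; rewrite mulrC; apply: IM. Qed.

Lemma ideal_subr I f g : is_ideal I -> I (f - g) -> I g -> I f.
Proof. by case=> _ ID _ Ifg Ig; rewrite -(subrK g f); apply: ID. Qed.

Lemma ideal_sum I (T : Type) (r : seq T) (P : pred T) (E : T -> R) :
  is_ideal I -> (forall i, P i -> I (E i)) -> I (\sum_(i <- r | P i) E i).
Proof. by case=> I0 ID _ IE; elim/big_ind: _. Qed.

Lemma ideal_adjoinP B gs : is_ideal B -> is_ideal (ideal_adjoin B gs).
Proof.
move=> idB; elim: gs => [//|g gs [I0 ID IM]] /=; split.
- by exists 0; rewrite mul0r subr0.
- move=> p q [a pa] [b qb]; exists (a + b).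
  by rewrite mulrDl opprD addrACA; apply: ID.
- by move=> p q [a qa]; exists (p * a); rewrite -mulrA -mulrBr; apply: IM.
Qed.

Lemma ideal_adjoin_weaken B g gs f :
  ideal_adjoin B gs f -> ideal_adjoin B (g :: gs) f.
Proof. by exists 0; rewrite mul0r subr0. Qed.

Lemma ideal_adjoin_base B gs f : B f -> ideal_adjoin B gs f.
Proof. by move=> Bf; elim: gs => // g gs; apply: ideal_adjoin_weaken. Qed.

Lemma ideal_adjoin_mem B gs g :
  is_ideal B -> g \in gs -> ideal_adjoin B gs g.
Proof.
move=> idB; elim: gs => // h gs IHgs; rewrite in_cons => /predU1P[->|/IHgs].
  by exists 1; rewrite mul1r subrr; case: (ideal_adjoinP gs idB).
exact: ideal_adjoin_weaken.
Qed.

Lemma ideal_adjoin_cat B gs hs f :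
  ideal_adjoin B (gs ++ hs) f <-> ideal_adjoin (ideal_adjoin B hs) gs f.
Proof.
elim: gs f => //= g gs IH f; split=> -[a /IH]; by exists a.
Qed.

Lemma ideal_adjoin_min B C gs : is_ideal C ->
  (forall f, B f -> C f) -> (forall g, g \in gs -> C g) ->
  forall f, ideal_adjoin B gs f -> C f.
Proof.
move=> idC BC; elim: gs => [_ //|g gs IHgs] gsC f /= [a fa].
apply: (@ideal_subr _ _ (a * g)) => //.
  by apply: IHgs fa => h hgs; apply: gsC; rewrite in_cons hgs orbT.
by case: idC => _ _; apply; apply: gsC; rewrite mem_head.
Qed.

End Ideals.

Section LocalChain.
Variables (F : fieldType) (R : comNzRingType).
Variables (ev : {rmorphism R -> F}) (cst : {rmorphism F -> R}).
Hypothesis cstK : cancel cst ev.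
Variables (B : R -> Prop) (ys : seq R).
Hypothesis idB : is_ideal B.
Hypothesis ys_gen : forall a, ev a = 0 -> ideal_adjoin B ys a.
Hypothesis ys_ev : forall y, y \in ys -> ev y = 0.

(* The contraction to R of the ideal generated by B and gs in the
   localization of R at the kernel of ev. *)
Definition local_ideal (gs : seq R) (f : R) : Prop :=
  exists2 u, ev u != 0 & ideal_adjoin B gs (u * f).

(** The maximal ideal is not nilpotent in the local ring, which keeps the chain from ending after
    finitely many steps. *)
Hypothesis ys_notnil :
  forall k, exists2 y, y \in ys & ~ local_ideal [::] (y ^+ k).

Lemma local_idealP gs : is_ideal (local_ideal gs).
Proof.
have [I0 ID IM] := ideal_adjoinP gs idB; split.
- by exists 1; rewrite ?rmorph1 ?oner_eq0// mulr0.
- move=> p q [u nu up] [w nw wq]; exists (u * w).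
    by rewrite rmorphM mulf_neq0.
  by rewrite mulrDr; apply: ID; [rewrite mulrAC mulrC|rewrite -mulrA]; apply: IM.
- by move=> p q [u nu uq]; exists u => //; rewrite mulrCA; apply: IM.
Qed.

Lemma local_ideal_sub gs f : ideal_adjoin B gs f -> local_ideal gs f.
Proof. by exists 1; rewrite ?rmorph1 ?oner_eq0// mul1r. Qed.

Lemma local_ideal_unit gs u f :
  ev u != 0 -> local_ideal gs (u * f) -> local_ideal gs f.
Proof.
move=> nu [w nw wuf]; exists (w * u); first by rewrite rmorphM mulf_neq0.
by rewrite -mulrA.
Qed.

Lemma local_ideal_min gs hs : (forall g, g \in gs -> local_ideal hs g) ->
  forall f, local_ideal gs f -> local_ideal hs f.
Proof.
move=> gshs f [u nu]; move/(ideal_adjoin_min (local_idealP hs)) => uf.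
apply: (local_ideal_unit nu); apply: uf => // g Bg.
exact/local_ideal_sub/ideal_adjoin_base.
Qed.

Lemma local_ideal_mem gs g : g \in gs -> local_ideal gs g.
Proof. by move=> ggs; apply/local_ideal_sub/ideal_adjoin_mem. Qed.

(** Redundant leading generators are discarded one by one. The list cannot run out, since by
    [ys_notnil] the ideal of [B] alone misses some [y ^+ k]. *)
Lemma local_ideal_ne gs k : (forall y, y \in ys -> local_ideal gs (y ^+ k)) ->
  exists g gs', [/\ forall f, local_ideal (g :: gs') f <-> local_ideal gs f &
    ~ local_ideal gs' g].
Proof.
elim: gs => [|g gs IH] gsk.
  by have [y yys] := ys_notnil k; case; apply: gsk.
have [ggs|] := pselect (local_ideal gs g); last by exists g, gs.
have eq_gs f : local_ideal (g :: gs) f <-> local_ideal gs f.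
  split; apply: local_ideal_min => h; last first.
    by move=> hgs; apply: local_ideal_mem; rewrite in_cons hgs orbT.
  by rewrite in_cons => /predU1P[->//|]; apply: local_ideal_mem.
case: IH => [y /gsk /eq_gs //|h [gs' [eq_gs' hgs']]].
by exists h, gs'; split=> // f; rewrite eq_gs' eq_gs.
Qed.

(* Nakayama's lemma for g modulo (gs): the identity
   u g = sum_y (b_y y) g + ... lets the unit u - sum_y b_y y absorb g. *)
Lemma local_ideal_nakayama g gs :
  local_ideal ([seq y * g | y <- ys] ++ gs) g -> local_ideal gs g.
Proof.
case=> u nu /ideal_adjoin_cat ug.
have : exists2 b, ev b = 0 & ideal_adjoin B gs (u * g - b * g).
  elim: (ys) ys_ev (u * g) ug => [_ f fgs|y s IH evs f /= [a]].
    by exists 0; rewrite ?rmorph0// mul0r subr0.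
  case/IH=> [z zs|b evb fab]; first by rewrite evs// in_cons zs orbT.
  exists (a * y + b).
    by rewrite rmorphD rmorphM/= evb (evs y) ?mem_head// mulr0 addr0.
  by rewrite mulrDl opprD addrA -mulrA.
case=> b evb bg; exists (u - b); first by rewrite rmorphB/= evb subr0.
by rewrite mulrBl.
Qed.

(** Two invariants carried down the chain: finite generation, for Nakayama, and a common power of
    the [ys], which keeps [J] strictly above the localization of [B]. *)
Record chain_ideal (J : R -> Prop) : Prop := ChainIdeal {
  chain_gen : exists gs, forall f, J f <-> local_ideal gs f;
  chain_pow : exists k, forall y, y \in ys -> J (y ^+ k) }.

Lemma chain_idealP J : chain_ideal J -> is_ideal J.
Proof.
move=> [[gs Jgs] _]; have [I0 ID IM] := local_idealP gs; split.
- exact/Jgs.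
- by move=> p q /Jgs Jp /Jgs Jq; apply/Jgs/ID.
- by move=> p q /Jgs Jq; apply/Jgs/IM.
Qed.

(** Write [J] as [(g) + (gs')] with [g] not redundant, and let [J'] be [m g + (gs')], where [m] is
    the maximal ideal. Then [J / J'] is spanned by [g] over the residue field, and Nakayama keeps
    [g] out of [J']. *)
Lemma chain_step J : chain_ideal J -> exists J' g,
  [/\ chain_ideal J', forall f, J' f -> J f, J g, ~ J' g &
      forall f, J f -> exists c, J' (f - cst c * g)].
Proof.
case=> -[gs Jgs] [k Jk].
have [|g [gs' [eq_gs ngs]]] := @local_ideal_ne gs k.
  by move=> y /Jk /Jgs.
pose hs := [seq y * g | y <- ys] ++ gs'.
have sub f : local_ideal hs f -> J f.
  move=> fhs; apply/Jgs/eq_gs; apply: local_ideal_min fhs => h.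
  have [_ _ IM] := local_idealP (g :: gs').
  rewrite mem_cat => /orP[/mapP[y _ ->]|hgs]; last first.
    by apply: local_ideal_mem; rewrite in_cons hgs orbT.
  by apply/IM/local_ideal_mem/mem_head.
have [I0 ID IM] := local_idealP hs.
have kerM a : ev a = 0 -> local_ideal hs (a * g).
  move=> /ys_gen.
  apply: (@ideal_adjoin_min _ _ (fun a => local_ideal hs (a * g))).
  - split; first by rewrite mul0r.
      by move=> p q; rewrite mulrDl; apply: ID.
    by move=> p q; rewrite -mulrA; apply: IM.
  - move=> b Bb; apply/local_ideal_sub/ideal_adjoin_base.
    exact: ideal_mulr.
  - move=> y yys; apply: local_ideal_mem.
    by rewrite mem_cat; apply/orP; left; apply/mapP; exists y.
have gen f : J f -> exists c, local_ideal hs (f - cst c * g).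
  (* Here [u f - a g] lies in [B + (gs')]. The constant [c] is chosen so that [a - u c] is in the
     kernel of [ev], hence [(a - u c) g] is in [J']. *)
  move=> /Jgs /eq_gs [u nu [a ua]]; exists (ev a / ev u).
  apply: (local_ideal_unit nu); rewrite mulrBr mulrA.
  rewrite -[u * f](subrK (a * g)) -addrA -mulrBl.
  apply: ID.
    apply: local_ideal_sub; apply/ideal_adjoin_cat.
    elim: (map _ _) => //= h s; apply: ideal_adjoin_weaken.
  apply: kerM; rewrite rmorphB rmorphM/= cstK mulrCA mulfV// mulr1 subrr//.
exists (local_ideal hs), g; split=> //.
- split; first by exists hs.
  (* Multiplying [y ^+ k - c g] by [y] stays in [J'], and [y g] is in [J'] by construction. *)
  exists k.+1 => y yys; have [c] := gen _ (Jk _ yys).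
  move/(IM y); rewrite mulrBr -exprS => /ideal_subr; apply; first exact: local_idealP.
  by rewrite mulrCA; apply/IM/kerM/ys_ev.
- by apply/Jgs/eq_gs/local_ideal_mem/mem_head.
- by move/local_ideal_nakayama.
Qed.

Lemma chain_exists : exists (J : nat -> R -> Prop) (g : nat -> R),
  [/\ forall k, is_ideal (J k),
      forall k f, B f -> J k f,
      forall k u f, ev u != 0 -> J k (u * f) -> J k f,
      forall f, J 0%N f &
      forall k, [/\ forall f, J k.+1 f -> J k f, J k (g k), ~ J k.+1 (g k) &
        forall f, J k f -> exists c, J k.+1 (f - cst c * g k)]].
Proof.
pose T := {J : R -> Prop | chain_ideal J}.
have step (J : T) : {p : T * R | [/\ forall f, sval p.1 f -> sval J f,
    sval J p.2, ~ sval p.1 p.2 &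
    forall f, sval J f -> exists c, sval p.1 (f - cst c * p.2)]}.
  apply: cid; have [J' [g [cJ' h1 h2 h3 h4]]] := chain_step (svalP J).
  by exists (exist _ J' cJ', g).
have top : chain_ideal (fun=> True).
  have one f : local_ideal [:: 1] f.
    by rewrite -[f]mulr1; case: (local_idealP [:: 1]) => _ _; apply;
      apply: local_ideal_mem; rewrite mem_head.
  by split; [exists [:: 1]|exists 0%N].
pose s k : T := iter k (fun J => (sval (step J)).1) (exist _ _ top).
exists (fun k => sval (s k)), (fun k => (sval (step (s k))).2); split => //.
- by move=> k; apply/chain_idealP/(svalP (s k)).
- move=> k f Bf; have [[gs Jgs] _] := svalP (s k).
  exact/Jgs/local_ideal_sub/ideal_adjoin_base.
- move=> k u f nu; have [[gs Jgs] _] := svalP (s k).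
  by move=> /Jgs /(local_ideal_unit nu) /Jgs.
- by move=> k; have := svalP (step (s k)).
Qed.

End LocalChain.

(** * Homogeneous polynomials and charts *)

Section Polynomials.
Variables (F : fieldType) (n : nat).
Implicit Types (p q : {mpoly F[n]}) (v : 'I_n -> F).

Lemma rmorph_mpolyE (T : comNzRingType) (phi : {rmorphism {mpoly F[n]} -> T}) p :
  phi p = mmap (phi \o mpolyC n (R:=F)) (fun j => phi 'X_j) p.
Proof.
rewrite {1}(mpolyE p) raddf_sum /mmap; apply: eq_bigr => m _ /=.
rewrite -mul_mpolyC rmorphM; congr (_ * _).
rewrite mpolyXE_id rmorph_prod; apply: eq_bigr => i _.
by rewrite rmorphXn.
Qed.

Lemma mmap_homog_scale (T : comNzRingType) (f : F -> T) (h : 'I_n -> T) c d p :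
  p \is d.-homog for mdeg ->
  mmap f (fun j => c * h j) p = c ^+ d * mmap f h p.
Proof.
move=> /dhomogP homp; rewrite /mmap mulr_sumr.
rewrite big_seq [RHS]big_seq; apply: eq_bigr => m /homp <-.
rewrite mulrCA; congr (_ * _); rewrite /mmap1 /= mdegE -prodrXr -big_split/=.
by apply: eq_bigr => i _; rewrite exprMn.
Qed.

Lemma ideal_subst (I : {mpoly F[n]} -> Prop) (h : n.-tuple {mpoly F[n]}) p :
  is_ideal I -> (forall j, I ('X_j - tnth h j)) -> I (p - (p \mPo h)).
Proof.
move=> idI Ih; have [I0 ID IM] := idI.
have congM a b c d : I (a - b) -> I (c - d) -> I (a * c - b * d).
  move=> Iab Icd; rewrite -(subrK (b * c) (a * c)) -addrA -mulrBl -mulrBr.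
  by apply: ID; [apply: ideal_mulr|apply: IM].
have IX (m : 'X_{1..n}) : I ('X_[m] - ('X_[m] \mPo h)).
  rewrite comp_mpolyX mpolyXE_id.
  elim/big_rec2: _ => [|i y1 y2 _]; first by rewrite subrr.
  apply: (congM); elim: (m i) => [|k IHk]; first by rewrite !expr0 subrr.
  by rewrite !exprS; apply: congM.
elim/mpolyind: p => [|c m p _ _ IHp]; first by rewrite comp_mpoly0 subrr.
rewrite comp_mpolyD comp_mpolyZ opprD addrACA; apply: ID => //.
by rewrite -scalerBr -mul_mpolyC; apply: IM.
Qed.

(** Modulo the ['X_j - v j], every polynomial is congruent to its value at [v]. *)
Lemma ideal_adjoin_point (I : {mpoly F[n]} -> Prop) v p : is_ideal I ->
  p.@[v] = 0 -> ideal_adjoin I [seq 'X_j - (v j)%:MP | j <- enum 'I_n] p.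
Proof.
move=> idI pv; pose h := [tuple (v j)%:MP_[n] | j < n].
rewrite -(subr0 p); have {1}<- : (p \mPo h) = 0.
  rewrite comp_mpolyEX -[RHS](mpolyC0 n) -pv mevalE rmorph_sum/=.
  apply: eq_bigr => m _; rewrite comp_mpolyX -mul_mpolyC rmorphM/= rmorph_prod.
  by congr (_ * _); apply: eq_bigr => i _; rewrite rmorphXn/= tnth_mktuple.
apply: ideal_subst; first exact: ideal_adjoinP.
move=> j; rewrite tnth_mktuple; apply: ideal_adjoin_mem => //.
by apply/mapP; exists j; rewrite ?mem_enum.
Qed.

End Polynomials.

Section Dehomogenization.
Variables (F : fieldType) (n : nat) (i : 'I_n).
Implicit Types (p q : {mpoly F[n]}) (v : 'I_n -> F).

(** The variable ['X_i] is set to 1 without leaving the ring, so a point with [v i = 1] keeps its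
    coordinates in the chart. *)
Definition dehomog : {mpoly F[n]} -> {mpoly F[n]} :=
  comp_mpoly [tuple if j == i then 1 else 'X_j | j < n].

HB.instance Definition _ := GRing.RMorphism.copy dehomog
  (comp_mpoly [tuple if j == i then 1 else 'X_j | j < n]).

Lemma dehomogX j : dehomog 'X_j = if j == i then 1 else 'X_j.
Proof. by rewrite /dehomog comp_mpolyXU -tnth_nth tnth_mktuple. Qed.

Lemma dehomogC c : dehomog c%:MP = c%:MP.
Proof. exact: comp_mpolyC. Qed.

Lemma meval_dehomog v p : v i = 1 -> (dehomog p).@[v] = p.@[v].
Proof.
move=> vi; rewrite /dehomog comp_mpoly_meval; apply: meval_eq => j.
rewrite tnth_mktuple; case: eqP => [->|_]; first by rewrite meval1 vi.
by rewrite mevalXU.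
Qed.

Lemma homogXn (j : 'I_n) k : ('X_j ^+ k : {mpoly F[n]}) \is k.-homog for mdeg.
Proof.
by rewrite -{2}[k]mul1n; apply: dhomogMn; rewrite dhomogX /= mdeg1.
Qed.

Lemma homog_shift p N k : p \is N.-homog for mdeg -> (N <= k)%N ->
  exists q, [/\ q \is k.-homog for mdeg, dehomog q = dehomog p &
    q = 'X_i ^+ (k - N) * p].
Proof.
move=> hp Nk; exists ('X_i ^+ (k - N) * p); split => //.
  by rewrite -{2}(subnK Nk); apply: dhomogM => //; apply: homogXn.
by rewrite rmorphM rmorphXn/= dehomogX eqxx expr1n mul1r.
Qed.

Lemma homogenize p : exists N0, forall N, (N0 <= N)%N ->
  exists2 q, q \is N.-homog for mdeg & dehomog q = dehomog p.
Proof.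
elim/mpolyind: p => [|c m p _ _ [N0 IH]].
  by exists 0%N => N _; exists 0; rewrite ?dhomog0.
exists (maxn (mdeg m) N0) => N; rewrite geq_max => /andP[mN /IH[q hq eq]].
have hm : (c *: 'X_[m] : {mpoly F[n]}) \is (mdeg m).-homog for mdeg.
  by rewrite rpredZ// dhomogX.
have [q' [hq' eq' _]] := homog_shift hm mN.
by exists (q' + q); rewrite ?rpredD// !rmorphD/= eq eq'.
Qed.

(** A form [r] of degree [N] is recovered from its dehomogenization: evaluating the latter at the
    fractions ['X_j / 'X_i] gives [r / 'X_i ^+ N]. *)
Lemma dehomog_inj N p q : p \is N.-homog for mdeg -> q \is N.-homog for mdeg ->
  dehomog p = dehomog q -> p = q.
Proof.
move=> hp hq /eqP; rewrite -subr_eq0 -rmorphB/= => /eqP epq.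
apply/eqP; rewrite -subr_eq0; set r := p - q in epq *.
have hr : r \is N.-homog for mdeg by rewrite rpredB.
pose c : {fraction {mpoly F[n]}} := (tofrac 'X_i)^-1.
pose cst := (@tofrac {mpoly F[n]}) \o (mpolyC n (R := F)).
have Xi0 : tofrac ('X_i : {mpoly F[n]}) != 0.
  by rewrite tofrac_eq0 -msupp_eq0 msuppX.
pose e : {rmorphism {mpoly F[n]} -> {fraction {mpoly F[n]}}} :=
  mmap cst (fun j => c * tofrac 'X_j).
have : (e \o dehomog) r = 0 by rewrite /= epq rmorph0.
rewrite (rmorph_mpolyE (e \o dehomog)).
have -> : mmap ((e \o dehomog) \o mpolyC n (R:=F)) (fun j => (e \o dehomog) 'X_j) r
    = mmap cst (fun j => c * tofrac 'X_j) r.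
  rewrite /mmap; apply: eq_bigr => m _ /=; congr (_ * _).
    by rewrite dehomogC /e mmapC.
  rewrite /mmap1; apply: eq_bigr => j _; congr (_ ^+ _).
  rewrite dehomogX; case: eqP => [->|_]; last by rewrite /e mmapX mmap1U.
  by rewrite rmorph1 /c mulVf.
rewrite (mmap_homog_scale _ _ _ hr) -(rmorph_mpolyE (@tofrac _)) => /eqP.
by rewrite mulf_eq0 tofrac_eq0 expf_eq0 invr_eq0 (negbTE Xi0) andbF.
Qed.

End Dehomogenization.

(** * Jets at a rational point *)

(* J is a composition series of the local ring at the point v of the curve
   defined by I, pulled back to the polynomial ring. *)
Record jet_chain (F : fieldType) (n : nat) (I : {mpoly F[n]} -> Prop)
    (v : 'I_n -> F) (J : nat -> {mpoly F[n]} -> Prop) : Prop := JetChain {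
  jet_ideal : forall k, is_ideal (J k);
  jet_sub : forall k f, I f -> J k f;
  jet_unit : forall k u f, u.@[v] != 0 -> J k (u * f) -> J k f;
  jet0 : forall f, J 0%N f;
  jetS : forall k f, J k.+1 f -> J k f;
  jet_codim : forall k f g, J k f -> J k g -> ~ J k.+1 g ->
    exists c, J k.+1 (f - c *: g);
  jetM : forall k a f, a.@[v] = 0 -> J k f -> J k.+1 (a * f);
  jet_homog : forall k, exists N0, forall N, (N0 <= N)%N ->
    exists g, [/\ g \is N.-homog for mdeg, J k g & ~ J k.+1 g] }.

Section JetChain.
Variables (F : fieldType) (n : nat) (I : {mpoly F[n]} -> Prop).
Variables (v : 'I_n -> F) (J : nat -> {mpoly F[n]} -> Prop).
Hypothesis chainJ : jet_chain I v J.

Lemma jet_le k l f : (k <= l)%N -> J l f -> J k f.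
Proof.
by move/subnK <-; elim: (l - k)%N => // m IHm /(jetS chainJ).
Qed.

Lemma jetX k a : a.@[v] = 0 -> J k (a ^+ k).
Proof.
move=> av; elim: k => [|k IHk]; first exact: (jet0 chainJ).
by rewrite exprS; apply: (jetM chainJ).
Qed.

End JetChain.

Lemma homog_ideal (F : fieldType) (n : nat) (I : poly_ring F n -> Prop) :
  homog_prime_ideal I -> is_ideal I.
Proof. by case=> -[]. Qed.

Lemma prime_ideal_exp (F : fieldType) (n : nat) (I : poly_ring F n -> Prop) p k :
  homog_prime_ideal I -> I (p ^+ k) -> I p.
Proof.
case=> _ [I1 Ipr]; elim: k => [//|k IHk].
by rewrite exprS => /Ipr [].
Qed.

Section Chart.
Variables (F : fieldType) (n : nat) (I : poly_ring F n -> Prop).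
Variables (v : 'I_n.+1 -> F) (i : 'I_n.+1).
Hypothesis prI : homog_prime_ideal I.
Hypothesis vi : v i = 1.
Hypothesis Iv : forall p, I p -> p.@[v] = 0.

(* The preimage, under 'X_i := 1, of the ideal of the affine chart 'X_i != 0. *)
Definition chart_ideal (f : poly_ring F n) : Prop :=
  exists N p, [/\ p \is N.-homog for mdeg, I p & dehomog i p = dehomog i f].

Lemma chart_ideal_eq f g : dehomog i f = dehomog i g -> chart_ideal (f - g).
Proof.
exists 0%N, 0; split; first exact: dhomog0; first by case: (homog_ideal prI).
by rewrite rmorph0 rmorphB/= H subrr.
Qed.

Lemma chart_idealP : is_ideal chart_ideal.
Proof.
have [I0 ID IM] := homog_ideal prI; split.
- by exists 0%N, 0; split => //; apply: dhomog0.
- move=> f g [N [p [hp Ip ep]]] [M [q [hq Iq eq]]].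
  have [p' [hp' ep' defp]] := homog_shift i hp (leq_maxl N M).
  have [q' [hq' eq' defq]] := homog_shift i hq (leq_maxr N M).
  exists (maxn N M), (p' + q'); split; first exact: rpredD.
    by apply: ID; rewrite ?defp ?defq; apply: IM.
  by rewrite !rmorphD/= ep' eq' ep eq.
- move=> f g [N [p [hp Ip ep]]].
  have [M /(_ M (leqnn M)) [q hq eq]] := homogenize i f.
  exists (M + N)%N, (q * p); split; [exact: dhomogM|exact: IM|].
  by rewrite !rmorphM/= eq ep.
Qed.

Lemma chart_ideal_sub f : I f -> chart_ideal f.
Proof.
move=> If; have [_ _ _ Ih] := prI.1.
rewrite (pihomog_partitionE (mf := mdeg) (leqnn (mmeasure mdeg f))).
apply: ideal_sum; first exact: chart_idealP.
move=> d _; exists d, (pihomog mdeg d f); split => //; first exact: pihomogP.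
exact: Ih.
Qed.

(** Homogenizing turns the hypothesis into [U * y ^+ k] in [I]. The form [U] does not vanish at [v],
    so it is outside [I], and primality leaves [y]. *)
Lemma chart_ideal_prime u j k : u.@[v] != 0 ->
  chart_ideal (u * ('X_j - (v j)%:MP) ^+ k) -> I ('X_j - v j *: 'X_i).
Proof.
move=> nu [N [p [hp Ip ep]]].
have [N0 /(_ (maxn N0 N) (leq_maxl _ _)) [U hU eU]] := homogenize i u.
set y := 'X_j - _.
have hy : y \is 1.-homog for mdeg by rewrite rpredB ?rpredZ// dhomogX /= mdeg1.
have hQ : U * y ^+ k \is (maxn N0 N + k).-homog for mdeg.
  by apply: dhomogM => //; rewrite -[k in k.-homog for _]mul1n; apply: dhomogMn.
have Nle : (N <= maxn N0 N + k)%N by rewrite (leq_trans (leq_maxr N0 N)) ?leq_addr.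
have [p' [hp' ep' defp]] := homog_shift i hp Nle.
have pQ : p' = U * y ^+ k.
  apply: (dehomog_inj (i := i) hp' hQ); rewrite ep' ep !rmorphM/= eU; congr (_ * _).
  rewrite !rmorphXn/= !rmorphB/= -mul_mpolyC rmorphM/= !dehomogC.
  by rewrite [dehomog i 'X_i]dehomogX eqxx mulr1.
have : I (U * y ^+ k) by rewrite -pQ defp; case: (homog_ideal prI) => _ _; apply.
case/(prI.2.2) => [/Iv U0|]; last exact: prime_ideal_exp.
by move: nu; rewrite -(meval_dehomog u vi) -eU (meval_dehomog U vi) U0 eqxx.
Qed.

Hypothesis not_point : ~ (forall j, I ('X_j - v j *: 'X_i)).

(** The abstract chain is applied to the chart. By [chart_ideal_prime], a nilpotent maximal ideal
    would force the curve to be the single point [v], against [not_point]. *)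
Lemma jet_chain_exists : exists J, jet_chain I v J.
Proof.
pose ys := [seq ('X_j - (v j)%:MP : poly_ring F n) | j <- enum 'I_n.+1].
pose ev : {rmorphism poly_ring F n -> F} := meval v.
pose cst : {rmorphism F -> poly_ring F n} := @mpolyC n.+1 F.
have cstK : cancel cst ev by move=> c; exact: mevalC.
have ys_gen a : ev a = 0 -> ideal_adjoin chart_ideal ys a.
  by move=> av; apply: ideal_adjoin_point => //; exact: chart_idealP.
have ys_ev y : y \in ys -> ev y = 0.
  by case/mapP => j _ ->; rewrite /ev /= mevalB mevalXU mevalC subrr.
have ys_ne k : exists2 y, y \in ys & ~ local_ideal ev chart_ideal [::] (y ^+ k).
  apply: contrapT => none; apply: not_point => j.
  have [u nu uB] : local_ideal ev chart_ideal [::] (('X_j - (v j)%:MP) ^+ k).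
    apply: contrapT => nj; apply: none; exists ('X_j - (v j)%:MP) => //.
    by apply/mapP; exists j; rewrite ?mem_enum.
  exact: chart_ideal_prime nu uB.
have [J [g [idJ BJ uJ J0 stepJ]]] :=
  chain_exists cstK chart_idealP ys_gen ys_ev ys_ne.
(* The quotient is a line, so any [h] outside [J k.+1] can replace the chosen generator [g k]. *)
have codim k f h : J k f -> J k h -> ~ J k.+1 h -> exists c, J k.+1 (f - c *: h).
  move=> Jf Jh nJh; have [_ _ _ gen] := stepJ k.
  have [a Ja] := gen _ Jf; have [b Jb] := gen _ Jh.
  have b0 : b != 0.
    by apply: contra_notN nJh => /eqP b0; move: Jb; rewrite b0 rmorph0 mul0r subr0.
  have [_ ID IM] := idJ k.+1; exists (a / b).
  have -> : f - (a / b) *: h = (f - cst a * g k) - cst (a / b) * (h - cst b * g k).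
    rewrite mulrBr mulrA -rmorphM divfK// opprB addrA subrK.
    by rewrite /cst mul_mpolyC.
  by apply: ideal_sub => //; apply: IM.
exists J; split => //.
- by move=> k f /chart_ideal_sub; apply: BJ.
- by move=> k f; case: (stepJ k) => h _ _ _; apply: h.
- move=> k a f av Jf; have [_ Jg nJg gen] := stepJ k.
  have [_ ID IM] := idJ k.+1; have [_ _ IMk] := idJ k.
  have [b Jb] := gen _ Jf.
  apply: (ideal_subr (idJ k.+1) (g := a * (cst b * g k))).
    by rewrite -mulrBr; apply: IM.
  rewrite mulrCA; apply: IM.
  (* If [a * g k] were congruent to [c * g k] with [c] nonzero, then [a - c] would be a unit at [v]
     and [g k] would fall into [J k.+1]. *)
  have [c] := gen _ (IMk a _ Jg); rewrite -mulrBl => Jac.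
  have [c0|c0] := eqVneq c 0; first by move: Jac; rewrite c0 rmorph0 subr0.
  case: nJg; apply: uJ Jac.
  by rewrite rmorphB/= cstK /ev av sub0r oppr_eq0.
- move=> k; have [_ Jg nJg gen] := stepJ k.
  have [N0 hN0] := homogenize i (g k); exists N0 => N /hN0 [q hq /esym eq].
  exists q; split=> //.
    by apply: (ideal_subr (idJ k) _ Jg); apply/BJ/chart_ideal_eq.
  apply: contra_not nJg => Jq.
  by apply: (ideal_subr (idJ k.+1) _ Jq); apply/BJ/chart_ideal_eq.
Qed.

End Chart.

(** * Bezout's inequality *)

Section IndependentFamilies.
Variables (F : fieldType) (n : nat) (I : poly_ring F n -> Prop).

Lemma indep_mod_fin (m : nat) (T : finType) (f : T -> poly_ring F n) :
  (forall t, is_homog m (f t)) ->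
  (forall c : T -> F, I (\sum_t c t *: f t) -> forall t, c t = 0) ->
  indep_mod m #|T| I.
Proof.
move=> hf indf; exists (fun i => f (enum_val i)); split=> [i|c Ic i].
  exact: hf.
have eqc : \sum_t c (enum_rank t) *: f t = \sum_i c i *: f (enum_val i).
  rewrite [RHS](reindex (@enum_rank T)) /=; last exact: onW_bij (enum_rank_bij T).
  by apply: eq_bigr => t _; rewrite enum_rankK.
have := indf (fun t => c (enum_rank t)); rewrite eqc.
by move=> /(_ Ic (enum_val i)); rewrite enum_valK.
Qed.

Lemma indep_mod_le (m k l : nat) : (k <= l)%N ->
  indep_mod m l I -> indep_mod m k I.
Proof.
move=> kl [f [hf indf]]; exists (fun i => f (widen_ord kl i)); split=> // c Ic i.
pose c' (j : 'I_l) := oapp c 0 (insub (val j) : option 'I_k).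
have c'E (j : 'I_k) : c' (widen_ord kl j) = c j.
  by rewrite /c' /= (_ : insub _ = Some j)//; exact: valK.
rewrite -c'E; apply: indf; rewrite (bigID (fun j : 'I_l => (j < k)%N)) /=.
rewrite [X in _ + X]big1 => [|j]; last first.
  by move=> /negbTE jk; rewrite /c' insubF// scale0r.
by rewrite addr0 (big_ord_narrow kl); under eq_bigr do rewrite c'E.
Qed.

End IndependentFamilies.

(** Consecutive values of the Hilbert polynomial differ by [d]; this is the only way the degree
    enters Bezout's inequality. *)
Lemma hilbert_jump (F : fieldType) (n : nat) (I : poly_ring F n -> Prop) d :
  irred_curve_of_degree I d -> exists m0, forall m, (m0 <= m)%N ->
  exists2 k, indep_mod m k I & ~ indep_mod m.+1 (k + d).+1 I.
Proof.
case=> _ _ [c [m0 hm0]]; exists m0 => m lem.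
have [k [[indk _] ek]] := hm0 _ lem.
have [l [[_ indl] el]] := hm0 _ (leqW lem).
exists k => //; suff -> : (k + d)%N = l by [].
apply/eqP; rewrite -eqz_nat PoszD ek el mulnS PoszD addrC addrA.
by rewrite [d%:Z + _]addrC -addrA [d%:Z + _]addrC addrA.
Qed.

(** Otherwise each form [p] of degree [m] is congruent to [p.@[v] *: 'X_i ^+ m], so the Hilbert
    function is at most 1, whereas it grows with slope [d > 0]. *)
Lemma curve_not_point (F : fieldType) (n : nat) (I : poly_ring F n -> Prop) d
    (v : 'I_n.+1 -> F) (i : 'I_n.+1) :
  irred_curve_of_degree I d -> ~ (forall j, I ('X_j - v j *: 'X_i)).
Proof.
move=> curI Iv; have [prI d0 _] := curI; have idI := homog_ideal prI.
have [I0 ID IM] := idI.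
have le1 m : ~ indep_mod m 2 I.
  move=> [f [hf indf]].
  pose h := [tuple v j *: ('X_i : poly_ring F n) | j < n.+1].
  have red p : is_homog m p -> I (p - p.@[v] *: 'X_i ^+ m).
    move=> hp; have := @ideal_subst _ _ I h p idI.
    rewrite (_ : p \mPo h = p.@[v] *: 'X_i ^+ m).
      by apply => j; rewrite tnth_mktuple.
    have -> : p \mPo h = mmap (@mpolyC _ F) (fun j => 'X_i * (v j)%:MP) p.
      rewrite /comp_mpoly /mmap; apply: eq_bigr => mo _; congr (_ * _).
      apply: mmap1_eq => j.
      by rewrite tnth_mktuple -mul_mpolyC mulrC.
    rewrite (mmap_homog_scale _ _ _ hp) mulrC -mul_mpolyC; congr (_ * _).
    rewrite mevalE /mmap rmorph_sum; apply: eq_bigr => mo _ /=.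
    rewrite rmorphM rmorph_prod; congr (_ * _).
    by apply: eq_bigr => j _; rewrite rmorphXn.
  have ord2 (c : 'I_2 -> F) : \sum_(j < 2) c j *: f j
      = c ord0 *: f ord0 + c (lift ord0 ord0) *: f (lift ord0 ord0).
    by rewrite big_ord_recl big_ord1.
  set f0 := f ord0 in ord2 *; set f1 := f (lift ord0 ord0) in ord2 *.
  have Iz p a : I p -> I (a *: p) by move=> Ip; rewrite -mul_mpolyC; apply: IM.
  have e1 : f1.@[v] = 0.
    pose c (j : 'I_2) := if j == ord0 then f1.@[v] else - f0.@[v].
    rewrite -[LHS]/(c ord0); apply: indf; rewrite ord2 /c /=.
    set a := f1.@[v]; set b := f0.@[v].
    have -> : a *: f0 + - b *: f1
        = a *: (f0 - b *: 'X_i ^+ m) - b *: (f1 - a *: 'X_i ^+ m).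
      by rewrite !scalerBr !scalerA opprB addrA mulrC subrK scaleNr.
    by apply: ideal_sub => //; apply/Iz/red/hf.
  have If1 : I f1 by have := red _ (hf (lift ord0 ord0)); rewrite -/f1 e1 scale0r subr0.
  have /(_ _ (lift ord0 ord0)) := indf (fun j => (j != ord0)%:R).
  rewrite ord2 /= scale0r add0r scale1r => /(_ If1) /eqP.
  by rewrite oner_eq0.
have [_ _ [c [M hM]]] := curI.
have [k [_ ek]] := hM M (leqnn _).
(* Two degrees further the Hilbert function has grown by [2 d], hence is at least 2. *)
have [l [[indl _] el]] := hM (M + 2)%N (leq_addr _ _).
apply: (le1 (M + 2)%N); apply: indep_mod_le indl.
suff : (k + 2 <= l)%N by apply: leq_trans; rewrite leq_addl.
rewrite -lez_nat PoszD ek el mulnDr PoszD -!addrA lerD2l addrC lerD2r.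
by rewrite lez_nat leq_pmull.
Qed.

Lemma separating_form (F : fieldType) (n : nat) (x y : 'I_n.+1 -> F) :
  normalized x -> normalized y -> ~ (x =1 y) ->
  exists l : poly_ring F n, [/\ l \is 1.-homog for mdeg, l.@[x] = 0 & l.@[y] != 0].
Proof.
move=> [i [xi xlt]] [i' [yi' ylt]] xy.
have [//|none] := pselect (exists l : poly_ring F n,
  [/\ l \is 1.-homog for mdeg, l.@[x] = 0 & l.@[y] != 0]).
case: xy => j.
(* If no form ['X_k - x k *: 'X_i] separates, [y] is a multiple of [x], and normalization forces the
   factor to be 1. *)
have eqy k : y k = x k * y i.
  apply: contrapT => /eqP nek; apply: none.
  exists ('X_k - x k *: 'X_i); split.
  - by rewrite rpredB ?rpredZ// dhomogX /= mdeg1.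
  - by rewrite mevalB mevalZ !mevalXU xi mulr1 subrr.
  - by rewrite mevalB mevalZ !mevalXU subr_eq0.
suff -> : y j = x j by [].
rewrite eqy (_ : y i = 1) ?mulr1//.
have ii' : i' = i.
  apply/ord_inj/eqP; rewrite eqn_leq (leqNgt i') (leqNgt i); apply/andP; split; apply/negP.
    move=> /ylt yi; move: yi'; rewrite eqy yi mulr0 => /esym/eqP.
    by rewrite oner_eq0.
  move=> /xlt xi'; move: yi'; rewrite eqy xi' mul0r => /esym/eqP.
  by rewrite oner_eq0.
by rewrite -ii'.
Qed.

Section Bezout.
Variables (F : fieldType) (n : nat) (I : poly_ring F n -> Prop) (d : nat).
Hypothesis curI : irred_curve_of_degree I d.
Variables (T : finType) (pt : T -> 'I_n.+1 -> F).
Variable J : T -> nat -> poly_ring F n -> Prop.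
Hypothesis pt_norm : forall P, normalized (pt P).
Hypothesis pt_inj : forall P Q, pt P =1 pt Q -> P = Q.
Hypothesis chainJ : forall P, jet_chain I (pt P) (J P).
Variable K : nat.

(** Take the product, over the other points, of [K]-th powers of linear forms vanishing there but
    not at [P]. *)
Lemma isolating_form P : exists e u, [/\ u \is e.-homog for mdeg,
  u.@[pt P] != 0 & forall Q, Q != P -> J Q K u].
Proof.
suff [e [u [hu uP uQ]]] : exists e u, [/\ u \is e.-homog for mdeg,
    u.@[pt P] != 0 & forall Q, Q \in enum T -> Q != P -> J Q K u].
  by exists e, u; split=> // Q; apply: uQ; rewrite mem_enum.
elim: (enum T) => [|R s [e [u [hu uP us]]]].
  by exists 0%N, 1; split=> //; [exact: dhomog1|rewrite meval1 oner_neq0].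
have [->|RP] := eqVneq R P.
  exists e, u; split=> // Q; rewrite in_cons => /predU1P[->|]; last exact: us.
  by rewrite eqxx.
have [|l [hl lR lP]] := separating_form (pt_norm R) (pt_norm P).
  by move/pt_inj/eqP; apply/negP.
exists (K + e)%N, (l ^+ K * u); split.
- by apply: dhomogM => //; rewrite -[K in K.-homog for _]mul1n; apply: dhomogMn.
- by rewrite mevalM rmorphXn/= mulf_neq0 ?expf_neq0.
- move=> Q; rewrite in_cons => /predU1P[-> _|Qs QP].
    by apply: ideal_mulr; [exact: (jet_ideal (chainJ R))|exact: jetX (chainJ R) _ _ lR].
  by have [_ _ IM] := jet_ideal (chainJ Q) K; apply/IM/us.
Qed.

Lemma dual_form P k : exists N0, forall N, (N0 <= N)%N ->
  exists f, [/\ f \is N.-homog for mdeg, forall Q, Q != P -> J Q K f,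
    J P k f & ~ J P k.+1 f].
Proof.
have [e [u [hu uP uQ]]] := isolating_form P.
have [N0 hN0] := jet_homog (chainJ P) k.
exists (e + N0)%N => N leN; have eN := leq_trans (leq_addr _ _) leN.
have [|g [hg Jg nJg]] := hN0 (N - e)%N; first by rewrite leq_subRL.
exists (u * g); split.
- by rewrite -(subnKC eN); apply: dhomogM.
- by move=> Q QP; apply: ideal_mulr; [exact: (jet_ideal (chainJ Q))|exact: uQ].
- by have [_ _ IM] := jet_ideal (chainJ P) k; apply: IM.
- by move/(jet_unit (chainJ P) uP).
Qed.

(** [A] counts intersection multiplicities truncated at [K]. In degree [m.+1], the multiples of [h]
    by a basis in degree [m] and one dual form per element of [A] are independent modulo [I], so
    [#|A|] is at most the jump [d]. *)
Lemma bezout (h : poly_ring F n) (A : {set T * 'I_K}) :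
  h \is 1.-homog for mdeg -> ~ I h ->
  (forall x, x \in A -> J x.1 x.2.+1 h) -> (#|A| <= d)%N.
Proof.
move=> hh nIh Ah; have [prI _ _] := curI; have [I0 ID IM] := homog_ideal prI.
have [m0 hm0] := hilbert_jump curI.
have /choice[N0 hN0] (x : T * 'I_K) := dual_form x.1 x.2.
pose m := (m0 + \sum_x N0 x)%N.
have leN x : (N0 x <= m.+1)%N.
  by rewrite leqW// (leq_trans _ (leq_addl _ _))// (bigD1 x)//= leq_addr.
have /choice[f hf] x := hN0 x _ (leN x).
have [k [b [hb indb]] jump] := hm0 m (leq_addr _ _).
rewrite leqNgt; apply/negP => ltA; apply: jump.
pose S := ('I_k + {x | x \in A})%type.
pose g (t : S) := match t with inl a => h * b a | inr x => f (val x) end.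
suff : indep_mod m.+1 #|{: S}| I.
  by apply: indep_mod_le; rewrite card_sum card_ord card_sig -addnS leq_add2l.
apply: (@indep_mod_fin _ _ _ _ _ g) => [[a|x]/=|c].
- by rewrite -add1n; apply: dhomogM => //; exact: hb.
- by have [] := hf (val x).
rewrite big_sumType/= => Ic.
(* The dual forms are triangular: modulo the jet ideal just below [x], the multiples of [h], the
   dual forms of higher level at the same point and those of level at least that of [x] at other
   points all vanish. Lower levels have zero coefficient by induction. *)
have cr x : c (inr x) = 0.
  have [j] := ubnP (val x).2; elim: j x => // j IHj x ltj.
  apply: contrapT => /eqP cx; have [_ _ Jx nJx] := hf (val x).
  have chP := chainJ (val x).1; have idP := jet_ideal chP (val x).2.+1.
  apply: nJx; rewrite -[f _]scale1r -(mulVf cx) -scalerA -mul_mpolyC.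
  have [_ _ IMx] := idP; apply: (IMx).
  have := jet_sub chP (val x).2.+1 Ic.
  rewrite (bigD1 x)//= addrCA => Jc; rewrite -(addrK (\sum_(a < k) c (inl a) *: (h * b a) +
    \sum_(y | y != x) c (inr y) *: f (val y)) (c (inr x) *: f (val x))).
  apply: (ideal_sub idP Jc); have [_ IDx _] := idP; apply: IDx.
    apply: ideal_sum => // a _; rewrite -mul_mpolyC; apply: IMx.
    by apply: ideal_mulr => //; apply: Ah; exact: valP.
  apply: ideal_sum => // y yx.
  have [ylt|yge] := ltnP (val y).2 (val x).2.
    by rewrite IHj ?scale0r; [case: idP|exact: leq_trans ylt _].
  rewrite -mul_mpolyC; apply: IMx; have [_ yQ Jy _] := hf (val y).
  have [eyx|nyx] := eqVneq (val x).1 (val y).1.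
    rewrite -eyx in Jy; apply: (jet_le chP _ Jy).
    rewrite ltn_neqAle yge andbT; apply: contra_neq yx => e.
    apply/val_inj/esym; move: eyx e.
    by case: (val x) (val y) => [P l] [Q l'] /= -> /ord_inj ->.
  by apply: (jet_le chP _ (yQ _ nyx)); exact: ltn_ord.
(* What remains is [h] times a combination of the [b a]; since [h] is not in the prime [I], the
   combination is. *)
case=> [a|//]; apply: (indb (fun a => c (inl a))); move: Ic; rewrite [X in _ + X]big1 => [|x _]; last first.
  by rewrite cr scale0r.
rewrite addr0; under eq_bigr do rewrite scalerAr.
by rewrite -mulr_sumr; case/(prI.2.2).
Qed.

End Bezout.

(** * Averaging over linear forms *)

Section FiniteLinearAlgebra.
Variables (F : finFieldType) (m : nat).

Lemma card_rV : #|{: 'rV[F]_m}| = (#|F| ^ m)%N.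
Proof. by rewrite card_mx mul1n. Qed.

Lemma card_codim1 (A B : {set 'rV[F]_m}) :
  (forall a b, a \in A -> b \in A -> b \notin B ->
    exists c : F, a - c *: b \in B) ->
  (#|A| <= #|F| * #|B|)%N.
Proof.
move=> AB; have [AsubB|/subsetPn[b bA nbB]] := boolP (A \subset B).
  rewrite (leq_trans (subset_leq_card AsubB))// leq_pmull//.
  by apply/card_gt0P; exists 0.
rewrite -cardsT -cardsX; apply: leq_trans (leq_imset_card (fun x => x.2 + x.1 *: b) _).
apply/subset_leq_card/fintype.subsetP => a aA; have [c Bc] := AB a b aA bA nbB.
by apply/imsetP; exists (c, a - c *: b); rewrite ?inE ?Bc//= subrK.
Qed.

Lemma card_rowspace k (M : 'M[F]_(k, m)) (A : {set 'rV[F]_m}) :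
  (forall a, a \in A -> (a <= M)%MS) -> (#|A| <= #|F| ^ \rank M)%N.
Proof.
move=> AM; rewrite -[\rank M]mul1n -card_mx -cardsT.
apply: leq_trans (leq_imset_card (fun w => w *m row_base M) _).
apply/subset_leq_card/fintype.subsetP => a /AM; rewrite -(eq_row_base M) => aM.
apply/imsetP; exists (a *m pinvmx (row_base M)); first by rewrite inE.
by rewrite mulmxKpV.
Qed.

(** Rank-nullity: [B] lies in the row space of [M] and [A] in the kernel of [M^T], whose dimensions
    add up to [m]. *)
Lemma card_orthogonal (A B : {set 'rV[F]_m}) :
  (forall a b, a \in A -> b \in B -> a *m b^T = 0) ->
  (#|A| * #|B| <= #|F| ^ m)%N.
Proof.
move=> AB; pose M : 'M[F]_(#|B|, m) := \matrix_(i < #|B|) (enum_val i).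
have rB b : b \in B -> (b <= M)%MS.
  move=> bB; rewrite -(enum_rankK_in bB bB).
  by rewrite -[X in (X <= _)%MS](rowK (fun i : 'I_#|B| => enum_val i)); apply: row_sub.
have rA a : a \in A -> (a <= kermx M^T)%MS.
  move=> aA; apply/sub_kermxP; apply: trmx_inj; rewrite trmx_mul trmxK trmx0.
  apply/row_matrixP => i; rewrite row_mul rowK row0.
  by apply: trmx_inj; rewrite trmx_mul trmxK AB ?trmx0 ?enum_valP.
apply: leq_trans (leq_mul (card_rowspace rA) (card_rowspace rB)) _.
by rewrite -expnD mxrank_ker mxrank_tr subnK// rank_leq_col.
Qed.

End FiniteLinearAlgebra.

Section LinearForms.
Variables (F : finFieldType) (n : nat).
Implicit Types a b : 'rV[F]_n.+1.

Definition linear_form a : poly_ring F n := \sum_j a 0 j *: 'X_j.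

Lemma linear_form_homog a : linear_form a \is 1.-homog for mdeg.
Proof. by apply: rpred_sum => j _; rewrite rpredZ// dhomogX /= mdeg1. Qed.

Lemma linear_formB a b c :
  linear_form (a - c *: b) = linear_form a - c *: linear_form b.
Proof.
rewrite /linear_form scaler_sumr -sumrB; apply: eq_bigr => j _.
by rewrite !mxE scalerBl scalerA.
Qed.

Lemma meval_linear_form a v : (linear_form a).@[v] = \sum_j a 0 j * v j.
Proof.
by rewrite /linear_form raddf_sum; apply: eq_bigr => j _; rewrite /= mevalZ mevalXU.
Qed.

Lemma card_jets (I : poly_ring F n -> Prop) v J k : jet_chain I v J ->
  (#|F| ^ n.+1 <= #|F| ^ k * #|[set a | `[< J k (linear_form a) >]]|)%N.
Proof.
move=> chJ; elim: k => [|k IHk].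
  rewrite expn0 mul1n -card_rV -cardsT; apply/subset_leq_card.
  by apply/fintype.subsetP => a _; rewrite !inE; apply: (jet0 chJ).
apply: leq_trans IHk _; rewrite expnSr -mulnA leq_mul2l; apply/orP; right.
apply: card_codim1 => a b; rewrite !inE => Ja Jb /asboolP nJb.
have [c Jc] := jet_codim chJ Ja Jb nJb.
by exists c; rewrite !inE linear_formB.
Qed.

End LinearForms.

(** The averaged inequality multiplied by [#|F| ^ K], which clears the negative powers of [q]. *)
Lemma rat_points_bound (F : finFieldType) (n : nat) (I : poly_ring F n -> Prop)
    (d K : nat) : irred_curve_of_degree I d ->
  (num_rat_points I * \sum_(j < K) #|F| ^ j <= #|F| ^ K * (d + K))%N.
Proof.
move=> curI; have [prI _ _] := curI.
rewrite /num_rat_points; set X := [set x | _].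
pose T := {x | x \in X}; pose pt (P : T) : 'I_n.+1 -> F := val P.
have ptX P : normalized (pt P) /\ forall p, I p -> p.@[pt P] = 0.
  by have := valP P; rewrite !inE.
have pt_inj P Q : pt P =1 pt Q -> P = Q.
  by move=> PQ; apply/val_inj/ffunP.
have /choice[J chJ] P : exists J, jet_chain I (pt P) J.
  have [[i [Pi _]] PI] := ptX P.
  by apply: (jet_chain_exists prI Pi PI); exact: curve_not_point curI.
pose V P k := [set a | `[< J P k (linear_form a) >]].
pose W := [set a | `[< I (linear_form a) >]].
have WV P k : W \subset V P k.
  apply/fintype.subsetP => a; rewrite !inE => Ia.
  exact: jet_sub (chJ P) _ _ Ia.
(* Coefficient vectors of forms in [I] are orthogonal to all rational points. *)
have cardW : (#|X| * #|W| <= #|F| ^ n.+1)%N.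
  pose row_of (x : {ffun 'I_n.+1 -> F}) : 'rV[F]_n.+1 := \row_j x j.
  have row_inj : injective row_of.
    move=> x y /matrixP exy; apply/ffunP => j.
    by have := exy 0 j; rewrite !mxE.
  rewrite -(card_imset _ row_inj) mulnC; apply: card_orthogonal => a b.
  rewrite !inE => Ia /imsetP[x]; rewrite !inE => -[_ xI] ->.
  apply/matrixP => i j; rewrite !mxE !ord1 -[RHS](xI _ Ia) meval_linear_form.
  by apply: eq_bigr => k _; rewrite !mxE.
(* Double counting: after exchanging the sums, [bezout] bounds the contribution of each form outside
   [W] by [d]. *)
have sum_le : (\sum_(x : T * 'I_K) #|V x.1 x.2.+1 :\: W| <= d * #|F| ^ n.+1)%N.
  have -> : (\sum_(x : T * 'I_K) #|V x.1 x.2.+1 :\: W|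
     = \sum_(a in ~: W) #|[set x : T * 'I_K | a \in V x.1 x.2.+1]|)%N.
    transitivity (\sum_(x : T * 'I_K) \sum_(a in V x.1 x.2.+1 :\: W) 1)%N.
      by apply: eq_bigr => x _; rewrite sum1_card.
    rewrite (exchange_big_dep (fun a => a \in ~: W)) /=; last first.
      by move=> x a _; rewrite !inE => /andP[].
    apply: eq_bigr => a; rewrite inE => aW; rewrite -sum1_card.
    by apply: eq_bigl => x; rewrite finset.in_setD aW [RHS]finset.in_set.
  apply: (@leq_trans (\sum_(a in ~: W) d)%N).
    apply: leq_sum => a; rewrite !inE => /asboolP nIa.
    apply: (bezout curI (fun P => (ptX P).1) pt_inj chJ (linear_form_homog a) nIa).
    by move=> x; rewrite !inE.
  rewrite sum_nat_const mulnC leq_mul2l; apply/orP; right.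
  by rewrite -card_rV max_card.
have cardT : #|{: T}| = #|X| by rewrite card_sig.
have V_le : (\sum_(x : T * 'I_K) #|V x.1 x.2.+1| <= (d + K) * #|F| ^ n.+1)%N.
  have -> : (\sum_(x : T * 'I_K) #|V x.1 x.2.+1|
      = \sum_(x : T * 'I_K) #|V x.1 x.2.+1 :\: W| + #|X| * K * #|W|)%N.
    have -> : (#|X| * K * #|W| = \sum_(x : T * 'I_K) #|W|)%N.
      by rewrite sum_nat_const card_prod cardT card_ord.
    rewrite -big_split/=.
    apply: eq_bigr => x _; have /finset.setIidPr VW := WV x.1 x.2.+1.
    by rewrite -(cardsID W (V _ _)) VW addnC.
  by rewrite mulnDl leq_add// mulnAC mulnC leq_mul2l cardW orbT.
have F0 : (0 < #|F|)%N by apply/card_gt0P; exists 0.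
rewrite -(@leq_pmul2r (#|F| ^ n.+1)%N) ?expn_gt0 ?F0// -mulnA.
apply: leq_trans (_ : (#|F| ^ K * \sum_(x : T * 'I_K) #|V x.1 x.2.+1| <= _)%N); last first.
  by rewrite -mulnA leq_mul2l V_le orbT.
rewrite -(pair_bigA _ (fun P (k : 'I_K) => #|V P k.+1|)) /= big_distrr/=.
rewrite -cardT -sum_nat_const; apply: leq_sum => P _.
(* Reversal pairs jet level [k.+1] with the power [#|F| ^ (K - k.+1)]. *)
rewrite (reindex_inj rev_ord_inj) big_distrl big_distrr/=; apply: leq_sum => k _.
have -> : (#|F| ^ K = #|F| ^ (K - k.+1) * #|F| ^ k.+1)%N.
  by rewrite -expnD subnK// ltn_ord.
rewrite -mulnA leq_mul2l; apply/orP; right.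
exact: card_jets (chJ P).
Qed.

(** * Passage to the limit *)

Lemma eventually_rat_points_le (R : realType) (F : finFieldType) (e : R) :
  0 < e -> exists d0 : nat, forall d, (d0 <= d)%N ->
  forall n (I : poly_ring F n -> Prop), irred_curve_of_degree I d ->
  (num_rat_points I)%:R <= (#|F|%:R - 1 + e) * d%:R.
Proof.
move=> e0; set q := #|F|; have q1 : (1 < q)%N by exact: finNzRing_gt1.
(* [K] exceeds [q / e], and [Q - 1 >= K], so [q <= e (Q - 1)]. *)
pose K := (Num.trunc ((q%:R : R) / e)).+1.
have eK : q%:R < e * K%:R.
  by rewrite mulrC -ltr_pdivrMr// Num.Theory.truncnS_gt.
pose Q := (q ^ K)%N.
have KQ : (K < Q)%N by exact: ltn_expl.
(* For such [d] the term [(q - 1) K Q] is at most [d]. Replacing [Q] by [Q - 1] in the main term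
   costs [(q - 1) d], so the total error is at most [q d <= e (Q - 1) d]. *)
exists (q * K * Q)%N => d led n I curI.
have Q1 : (0 : R) < Q%:R - 1.
  by rewrite subr_gt0 ltr1n (leq_ltn_trans _ KQ).
have bound : (num_rat_points I)%:R * (Q%:R - 1) <= (q%:R - 1) * (Q%:R * (d%:R + K%:R)) :> R.
  have := rat_points_bound K curI; rewrite -/q -/Q => le_nat.
  (* Multiplication by [q - 1] sums the geometric series to [Q - 1]. *)
  have : (num_rat_points I * Q.-1 <= q.-1 * (Q * (d + K)))%N.
    by rewrite /Q predn_exp mulnCA leq_mul2l le_nat orbT.
  rewrite -(ler_nat R) !natrM natrD -!subn1 !natrB//; first exact: ltnW.
  by rewrite (leq_ltn_trans _ KQ).
rewrite -(ler_pM2r Q1); apply: (le_trans bound).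
have led' : q%:R * K%:R * Q%:R <= d%:R :> R by rewrite -!natrM ler_nat.
have d0 : (0 : R) <= d%:R by rewrite ler0n.
have K1 : K%:R + 1 <= Q%:R :> R by rewrite natr1 ler_nat.
have qR : (1 : R) < q%:R by rewrite ltr1n.
have eQ : q%:R <= e * (Q%:R - 1).
  by apply: (le_trans (ltW eK)); rewrite ler_pM2l// lerBrDr.
have h1 : q%:R * d%:R <= e * (Q%:R - 1) * d%:R by rewrite ler_wpM2r.
have h2 : (q%:R - 1) * K%:R * Q%:R <= q%:R * K%:R * Q%:R :> R.
  by apply: ler_wpM2r => //; apply: ler_wpM2r => //; rewrite gerBl.
lra.
Qed.

Theorem theorem1p1 (F : finFieldType) :
  (Homma_const F <= ((#|F|%:R - 1)%R : Rdefinitions.R)%:E)%E.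
Proof.
apply/lee_addgt0Pr => e e0; rewrite -EFinD.
have [d0 hd0] := eventually_rat_points_le F e0.
(* The limsup is at most the supremum over a tail; starting at [d0.+1] makes [d] positive, so
   division by [d] is genuine. *)
apply: (@le_trans _ _ (ereal_sup [set (M_q F d * ((d%:R)^-1)%:E)%E | d in
    [set d | (d0.+1 <= d)%N]]%classic)).
  apply: ereal_inf_lbound; exists [set d | (d0.+1 <= d)%N]%classic => //.
  by exists d0.+1.
apply: ge_ereal_sup => _ [d /= led <-].
have dR : (0 : Rdefinitions.R) < d%:R by rewrite ltr0n (leq_trans _ led).
have : (M_q F d <= ((#|F|%:R - 1 + e) * d%:R)%:E)%E.
  apply: ge_ereal_sup => _ [k [n [I [curI ->]]] <-].
  by rewrite lee_fin; apply: hd0 curI; exact: ltnW.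
move=> leM; apply: le_trans (lee_wpmul2r _ leM) _; first by rewrite lee_fin invr_ge0 ltW.
by rewrite -EFinM mulfK// gt_eqF.
Qed.
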